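(* Consider the $D_4^{(1)}$ system (defined in the context) restricted to parameters with $\alpha_4=\alpha_3=\alpha_1$, and set $\beta_0:=\alpha_0$, $\beta_1:=\alpha_2$, $\beta_2:=\alpha_3$, so that $\beta_0+2\beta_1+3\beta_2=1$. This system admits the affine Weyl group symmetry of type $G_2^{(1)}$ as the group of its Bäcklund transformations, whose generators are explicitly given as follows, with the notation $( * ):=(x,y,z;\beta_0,\beta_1,\beta_2)$: $$\begin{aligned} s_0:( * )&\rightarrow\left(x,y,z-\tfrac{\beta_0}{x-\eta};-\beta_0,\beta_1+\beta_0,\beta_2\right),\\ s_1:( * )&\rightarrow\left(x+\tfrac{\beta_1}{z},y+\tfrac{\beta_1}{z},z;\beta_0+\beta_1,-\beta_1,\beta_2+\beta_1\right),\\ s_2:( * )&\rightarrow\left(x,y,z-\tfrac{\beta_2\{y(y-1)+x(y-1)+xy\}}{xy(y-1)};\beta_0,\beta_1+3\beta_2,-\beta_2\right). \end{aligned}$$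
   Context: A Bäcklund transformation of a parametrized system is a birational transformation of the variables and parameters that takes the system with the original parameters to the system of the same form with the transformed parameters (here $\eta$ and $b(t)$ are unchanged). Affine Weyl group symmetry of type $G_2^{(1)}$ means that each $s_i$ is a Bäcklund transformation and that the $s_i$ satisfy the fundamental relations of the affine Weyl group of type $G_2^{(1)}$: $s_i^2=1$, $(s_0s_1)^3=1$, $(s_1s_2)^6=1$, $(s_0s_2)^2=1$. The $D_4^{(1)}$ system. Let $\eta\in\mathbb{C}\setminus\{0\}$, let $b(t)\in\mathbb{C}(t)$ be nonzero, and let $\alpha_0,\dots,\alpha_4\in\mathbb{C}$ satisfy $\alpha_0+\alpha_1+2\alpha_2+\alpha_3+\alpha_4=1$. The $D_4^{(1)}$ system for unknown functions $x,y,z$ of $t$ is $$\frac{2\eta}{b(t)}\frac{dx}{dt}=P,\qquad -\frac{2\eta}{b(t)}\frac{dy}{dt}=Q,\qquad \frac{2\eta}{b(t)}\frac{dz}{dt}=R,$$ where $P=-2x(y-1)yz(x-\eta)(2x-2y+1-\eta)-2(2\alpha_0+2\alpha_1+4\alpha_2+\alpha_3+\alpha_4)x^3y-2(\alpha_0+\alpha_1)xy^3+(5\alpha_0+5\alpha_1+6\alpha_2+\alpha_3+\alpha_4)x^2y^2-\{5\alpha_0+5\alpha_1+6\alpha_2+2\alpha_3-3(2\alpha_0+2\alpha_1+4\alpha_2+\alpha_3+\alpha_4)\eta\}x^2y+\{3(\alpha_0+\alpha_1)-(4\alpha_0+6\alpha_1+6\alpha_2+\alpha_3+\alpha_4)\eta\}xy^2+x^4+2(\alpha_0+\alpha_1+2\alpha_2+\alpha_3-\eta)x^3+2\alpha_1\eta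 y^3+\{(\alpha_0+\alpha_1+2\alpha_2+\alpha_3)(\eta^2-3\eta+1)+\alpha_4\eta^2\}x^2+\alpha_1(\eta-3)\eta y^2+\{-(\alpha_0+\alpha_1)+2(2\alpha_0+3\alpha_1+3\alpha_2+\alpha_3)\eta-(2\alpha_0+2\alpha_1+4\alpha_2+\alpha_3+\alpha_4)\eta^2\}xy+(\alpha_0+\alpha_1+2\alpha_2+\alpha_3)(\eta-1)\eta x-\alpha_1(\eta-1)\eta y$, $Q=2x(y-1)yz(x-\eta)(2x-2y+1-\eta)-2(\alpha_3+\alpha_4)x^3y-2(\alpha_0+\alpha_1+4\alpha_2+2\alpha_3+2\alpha_4)xy^3+(\alpha_0+\alpha_1+6\alpha_2+5\alpha_3+5\alpha_4)x^2y^2+\{-(\alpha_0+\alpha_1+6\alpha_2+4\alpha_3+6\alpha_4)+3(\alpha_3+\alpha_4)\eta\}x^2y+\{3(\alpha_0+\alpha_1+4\alpha_2+2\alpha_3+2\alpha_4)-(2\alpha_0+6\alpha_2+5\alpha_3+5\alpha_4)\eta\}xy^2+y^4+2\alpha_4x^3+2\{(\alpha_0+2\alpha_2+\alpha_3+\alpha_4)\eta-1\}y^3-\alpha_4(3\eta-1)x^2+\{1-3(\alpha_0+2\alpha_2+\alpha_3+\alpha_4)\eta+(\alpha_0+2\alpha_2+\alpha_3+\alpha_4)\eta^2\}y^2+\{-(\alpha_0+\alpha_1+4\alpha_2+2\alpha_3+2\alpha_4)+2(\alpha_0+3\alpha_2+2\alpha_3+3\alpha_4)\eta-(\alpha_3+\alpha_4)\eta^2\}xy+\alpha_4(\eta-1)\eta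 x-(\alpha_0+2\alpha_2+\alpha_3+\alpha_4)(\eta-1)\eta y$, $R=(2x-2y+1-\eta)\{2x^2y+2xy^2-x^2-\eta y^2-2(\eta+1)xy+\eta(x+y)\}z^2+z\big[-2(\alpha_3+\alpha_4)x^3+2(\alpha_0+\alpha_1)y^3+2(\alpha_0+\alpha_1+6\alpha_2+2\alpha_3+2\alpha_4)x^2y-2(2\alpha_0+2\alpha_1+6\alpha_2+\alpha_3+\alpha_4)xy^2+\{-(\alpha_0+\alpha_1+6\alpha_2+4\alpha_3)+3(\alpha_3+\alpha_4)\eta\}x^2+\{-3(\alpha_0+\alpha_1)+(4\alpha_0+6\alpha_2+\alpha_3+\alpha_4)\eta\}y^2-4\{-(\alpha_0+\alpha_1+3\alpha_2+\alpha_3)+(\alpha_0+3\alpha_2+\alpha_3+\alpha_4)\eta\}xy+\{-(\alpha_0+\alpha_1+4\alpha_2+2\alpha_3)+2(\alpha_0+3\alpha_2+2\alpha_3)\eta-(\alpha_3+\alpha_4)\eta^2\}x+\{\alpha_0+\alpha_1-2(2\alpha_0+3\alpha_2+\alpha_3)\eta+(2\alpha_0+4\alpha_2+\alpha_3+\alpha_4)\eta^2\}y-(\alpha_0+2\alpha_2+\alpha_3)(\eta-1)\eta\big]+\alpha_2\big[(\alpha_0+\alpha_1+2\alpha_2-\alpha_3-\alpha_4)x^2+(\alpha_0+\alpha_1-2\alpha_2-\alpha_3-\alpha_4)y^2-2(\alpha_0+\alpha_1-\alpha_3-\alpha_4)xy+\{\alpha_0+\alpha_1-2\alpha_3-(2\alpha_0+2\alpha_2-\alpha_3-\alpha_4)\eta\}x+\{-\alpha_0-\alpha_1+2\alpha_2+2\alpha_3+(2\alpha_0-\alpha_3-\alpha_4)\eta\}y+(\eta-1)(\alpha_2+\alpha_3+(\alpha_0+\alpha_2)\eta)\big]$.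 *)

(* Defs.v *)
From HB Require Import structures.
From mathcomp Require Import all_boot all_order all_algebra.
From mathcomp Require Import complex mpoly.
From mathcomp Require Import reals.

Set Implicit Arguments.
Unset Strict Implicit.
Unset Printing Implicit Defensive.

Import GRing.Theory.
Local Open Scope ring_scope.

Definition ratC (R : realType) : fieldType := {fraction {poly R[i]}}.

Definition ratC_const (R : realType) (c : R[i]) : ratC R := tofrac c%:P.

Definition ratC_t (R : realType) : ratC R := tofrac 'X.

(* (K, D) is a differential field containing (C(t), d/dt) through iota, for
   instance a field of meromorphic functions of t.  A derivation killing C and
   sending t to 1 is necessarily d/dt on C(t). *)
Definition extends_ddt (R : realType) (K : fieldType)
    (iota : {rmorphism ratC R -> K}) (D : K -> K) : Prop :=
  [/\ forall u v, D (u + v) = D u + D v,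
      forall u v, D (u * v) = D u * v + u * D v,
      forall c : R[i], D (iota (ratC_const c)) = 0
    & D (iota (ratC_t R)) = 1].

Definition D4_P (K : fieldType) (e a0 a1 a2 a3 a4 x y z : K) : K :=
  - 2 * x * (y - 1) * y * z * (x - e) * (2 * x - 2 * y + 1 - e)
  - 2 * (2 * a0 + 2 * a1 + 4 * a2 + a3 + a4) * x ^+ 3 * y
  - 2 * (a0 + a1) * x * y ^+ 3
  + (5 * a0 + 5 * a1 + 6 * a2 + a3 + a4) * x ^+ 2 * y ^+ 2
  - (5 * a0 + 5 * a1 + 6 * a2 + 2 * a3
     - 3 * (2 * a0 + 2 * a1 + 4 * a2 + a3 + a4) * e) * x ^+ 2 * y
  + (3 * (a0 + a1) - (4 * a0 + 6 * a1 + 6 * a2 + a3 + a4) * e) * x * y ^+ 2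
  + x ^+ 4
  + 2 * (a0 + a1 + 2 * a2 + a3 - e) * x ^+ 3
  + 2 * a1 * e * y ^+ 3
  + ((a0 + a1 + 2 * a2 + a3) * (e ^+ 2 - 3 * e + 1) + a4 * e ^+ 2) * x ^+ 2
  + a1 * (e - 3) * e * y ^+ 2
  + (- (a0 + a1) + 2 * (2 * a0 + 3 * a1 + 3 * a2 + a3) * e
     - (2 * a0 + 2 * a1 + 4 * a2 + a3 + a4) * e ^+ 2) * x * y
  + (a0 + a1 + 2 * a2 + a3) * (e - 1) * e * x
  - a1 * (e - 1) * e * y.

Definition D4_Q (K : fieldType) (e a0 a1 a2 a3 a4 x y z : K) : K :=
  2 * x * (y - 1) * y * z * (x - e) * (2 * x - 2 * y + 1 - e)
  - 2 * (a3 + a4) * x ^+ 3 * y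
  - 2 * (a0 + a1 + 4 * a2 + 2 * a3 + 2 * a4) * x * y ^+ 3
  + (a0 + a1 + 6 * a2 + 5 * a3 + 5 * a4) * x ^+ 2 * y ^+ 2
  + (- (a0 + a1 + 6 * a2 + 4 * a3 + 6 * a4) + 3 * (a3 + a4) * e) * x ^+ 2 * y
  + (3 * (a0 + a1 + 4 * a2 + 2 * a3 + 2 * a4)
     - (2 * a0 + 6 * a2 + 5 * a3 + 5 * a4) * e) * x * y ^+ 2
  + y ^+ 4
  + 2 * a4 * x ^+ 3
  + 2 * ((a0 + 2 * a2 + a3 + a4) * e - 1) * y ^+ 3
  - a4 * (3 * e - 1) * x ^+ 2
  + (1 - 3 * (a0 + 2 * a2 + a3 + a4) * e
     + (a0 + 2 * a2 + a3 + a4) * e ^+ 2) * y ^+ 2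
  + (- (a0 + a1 + 4 * a2 + 2 * a3 + 2 * a4)
     + 2 * (a0 + 3 * a2 + 2 * a3 + 3 * a4) * e
     - (a3 + a4) * e ^+ 2) * x * y
  + a4 * (e - 1) * e * x
  - (a0 + 2 * a2 + a3 + a4) * (e - 1) * e * y.

Definition D4_R (K : fieldType) (e a0 a1 a2 a3 a4 x y z : K) : K :=
  (2 * x - 2 * y + 1 - e)
  * (2 * x ^+ 2 * y + 2 * x * y ^+ 2 - x ^+ 2 - e * y ^+ 2
     - 2 * (e + 1) * x * y + e * (x + y)) * z ^+ 2
  + z * (- 2 * (a3 + a4) * x ^+ 3
         + 2 * (a0 + a1) * y ^+ 3
         + 2 * (a0 + a1 + 6 * a2 + 2 * a3 + 2 * a4) * x ^+ 2 * y
         - 2 * (2 * a0 + 2 * a1 + 6 * a2 + a3 + a4) * x * y ^+ 2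
         + (- (a0 + a1 + 6 * a2 + 4 * a3) + 3 * (a3 + a4) * e) * x ^+ 2
         + (- 3 * (a0 + a1) + (4 * a0 + 6 * a2 + a3 + a4) * e) * y ^+ 2
         - 4 * (- (a0 + a1 + 3 * a2 + a3) + (a0 + 3 * a2 + a3 + a4) * e) * x * y
         + (- (a0 + a1 + 4 * a2 + 2 * a3) + 2 * (a0 + 3 * a2 + 2 * a3) * e
            - (a3 + a4) * e ^+ 2) * x
         + (a0 + a1 - 2 * (2 * a0 + 3 * a2 + a3) * e
            + (2 * a0 + 4 * a2 + a3 + a4) * e ^+ 2) * y
         - (a0 + 2 * a2 + a3) * (e - 1) * e)
  + a2 * ((a0 + a1 + 2 * a2 - a3 - a4) * x ^+ 2
          + (a0 + a1 - 2 * a2 - a3 - a4) * y ^+ 2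
          - 2 * (a0 + a1 - a3 - a4) * x * y
          + (a0 + a1 - 2 * a3 - (2 * a0 + 2 * a2 - a3 - a4) * e) * x
          + (- a0 - a1 + 2 * a2 + 2 * a3 + (2 * a0 - a3 - a4) * e) * y
          + (e - 1) * (a2 + a3 + (a0 + a2) * e)).

(* (x, y, z) is a solution in (K, D); the constraint on the parameters is part
   of the definition of the system. *)
Definition D4_system (R : realType) (eta : R[i]) (b : ratC R)
    (K : fieldType) (iota : {rmorphism ratC R -> K}) (D : K -> K)
    (alpha0 alpha1 alpha2 alpha3 alpha4 : R[i]) (x y z : K) : Prop :=
  let c (a : R[i]) := iota (ratC_const a) in
  let k := 2 * c eta / iota b in
  [/\ alpha0 + alpha1 + 2 * alpha2 + alpha3 + alpha4 = 1,
      k * D x = D4_P (c eta) (c alpha0) (c alpha1) (c alpha2) (c alpha3)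
                     (c alpha4) x y z,
      - k * D y = D4_Q (c eta) (c alpha0) (c alpha1) (c alpha2) (c alpha3)
                       (c alpha4) x y z
    & k * D z = D4_R (c eta) (c alpha0) (c alpha1) (c alpha2) (c alpha3)
                     (c alpha4) x y z].

(* alpha4 = alpha3 = alpha1, with beta0 = alpha0, beta1 = alpha2 and
   beta2 = alpha3. *)
Definition restricted_D4_system (R : realType) (eta : R[i]) (b : ratC R)
    (K : fieldType) (iota : {rmorphism ratC R -> K}) (D : K -> K)
    (beta0 beta1 beta2 : R[i]) (x y z : K) : Prop :=
  D4_system eta b iota D beta0 beta2 beta1 beta2 beta2 x y z.

(* Field of rational functions, over C(t), on the space of all
   (x, y, z; beta0, beta1, beta2) with beta0 + 2 beta1 + 3 beta2 = 1.
   The indeterminates are x, y, z, beta1, beta2, in this order. *)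
Definition function_field (R : realType) : fieldType :=
  {fraction {mpoly (ratC R)[5]}}.

Section Coordinates.
Variable R : realType.

Definition ff_scalar (c : ratC R) : function_field R := tofrac c%:MP_[5].

Definition ff_var (i : 'I_5) : function_field R := tofrac ('X_i : {mpoly (ratC R)[5]}).

Definition ff_x := ff_var (@Ordinal 5 0 isT).
Definition ff_y := ff_var (@Ordinal 5 1 isT).
Definition ff_z := ff_var (@Ordinal 5 2 isT).
Definition ff_beta1 := ff_var (@Ordinal 5 3 isT).
Definition ff_beta2 := ff_var (@Ordinal 5 4 isT).
Definition ff_beta0 : function_field R := 1 - 2 * ff_beta1 - 3 * ff_beta2.

End Coordinates.

(* The rational function f is defined at the K-point p and takes value v. *)
Definition takes_value (R : realType) (K : fieldType)
    (iota : {rmorphism ratC R -> K}) (f : function_field R)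
    (p : 5.-tuple K) (v : K) : Prop :=
  exists n d : {mpoly (ratC R)[5]},
    [/\ f = tofrac n / tofrac d,
        mmap iota (tnth p) d != 0
      & v = mmap iota (tnth p) n / mmap iota (tnth p) d].

(* A birational transformation is represented by its pull-back s, an
   automorphism of the function field: the transformed coordinates are the
   images under s of the coordinate functions. *)
Definition coordinate_images (R : realType)
    (s : {rmorphism function_field R -> function_field R}) :=
  (s (ff_x R), s (ff_y R), s (ff_z R),
   s (ff_beta0 R), s (ff_beta1 R), s (ff_beta2 R)).

Definition birational (R : realType)
    (s : {rmorphism function_field R -> function_field R}) : Prop :=
  bijective s /\ forall c : ratC R, s (ff_scalar c) = ff_scalar c.

(* For all complex parameters, every solution (x, y, z) at which s is defined is
   sent to a solution (x', y', z') of the system with the transformed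
   parameters, which are again complex numbers.  The solutions range over all
   differential extensions of C(t), in particular C(t)(x, y, z) with the
   derivation defined by the system itself. *)
Definition preserves_system (R : realType) (eta : R[i]) (b : ratC R)
    (s : {rmorphism function_field R -> function_field R}) : Prop :=
  forall (K : fieldType) (iota : {rmorphism ratC R -> K}) (D : K -> K),
  extends_ddt iota D ->
  forall (beta0 beta1 beta2 : R[i]) (x y z : K),
  restricted_D4_system eta b iota D beta0 beta1 beta2 x y z ->
  let p := [tuple x; y; z; iota (ratC_const beta1); iota (ratC_const beta2)] in
  forall x' y' z' b0' b1' b2' : K,
  takes_value iota (s (ff_x R)) p x' ->
  takes_value iota (s (ff_y R)) p y' ->
  takes_value iota (s (ff_z R)) p z' ->
  takes_value iota (s (ff_beta0 R)) p b0' ->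
  takes_value iota (s (ff_beta1 R)) p b1' ->
  takes_value iota (s (ff_beta2 R)) p b2' ->
  exists beta0' beta1' beta2' : R[i],
    [/\ b0' = iota (ratC_const beta0'),
        b1' = iota (ratC_const beta1'),
        b2' = iota (ratC_const beta2')
      & restricted_D4_system eta b iota D beta0' beta1' beta2' x' y' z'].

Definition Backlund_transformation (R : realType) (eta : R[i]) (b : ratC R)
    (s : {rmorphism function_field R -> function_field R}) : Prop :=
  birational s /\ preserves_system eta b s.

(* Pull-back reverses products, which does not matter below: each
   relation is equivalent to its reversal once the s_i are involutions. *)
Definition affine_Weyl_G2_relations (T : Type) (s0 s1 s2 : T -> T) : Prop :=
  [/\ s0 \o s0 =1 id, s1 \o s1 =1 id & s2 \o s2 =1 id] /\
  [/\ iter 3 (s0 \o s1) =1 id,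
      iter 6 (s1 \o s2) =1 id
    & iter 2 (s0 \o s2) =1 id].

Definition affine_Weyl_G2_symmetry (R : realType) (eta : R[i]) (b : ratC R)
    (s0 s1 s2 : {rmorphism function_field R -> function_field R}) : Prop :=
  [/\ Backlund_transformation eta b s0,
      Backlund_transformation eta b s1,
      Backlund_transformation eta b s2
    & affine_Weyl_G2_relations s0 s1 s2].

(* Main.v *)
From HB Require Import structures.
Require Import Defs.
From mathcomp Require Import all_boot all_order all_algebra.
From mathcomp Require Import complex mpoly.
From mathcomp Require Import boolp reals ring.

Set Implicit Arguments.
Unset Strict Implicit.
Unset Printing Implicit Defensive.

Import GRing.Theory.
Local Open Scope ring_scope.

(** Why the theorem holds.

    Existence.  Each s_i is given by a substitution of rational functions for
    the coordinates.  A substitution extends to fractions as soon as it kills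
    no nonzero polynomial, and this is automatic when it is formally its own
    inverse: reading the substituted polynomial at the substituted point gives
    the original polynomial back ([involutive_substitution]).  So each s_i is
    an automorphism of order two of the function field.

    Backlund property.  The derivation kills the parameters, so the chain rule
    turns the claim for each s_i into three identities between rational
    functions of x, y, z and the parameters, namely that the vector field of
    the system is invariant under the substitution ([restricted_P_s0] to
    [restricted_R_s2], used in [s0_solution], [s1_solution] and
    [s2_solution]).  A solution at which s_i is defined avoids the poles
    x = eta, z = 0 and x y (y - 1) = 0, even when the parameter in the numerator
    vanishes there: the residue is a nonzero function on the polar divisor, so
    every denominator of the transformed coordinate vanishes on the whole
    divisor ([pole_no_value]).

    Relations.  An automorphism of the function field over its scalars is
    determined by its coordinates, and appending a generator to a word changes
    these coordinates by an explicit rational move ([coords_compose0],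
    [coords_compose1], [coords_compose2]); the denominators that occur are
    images of nonzero functions.  As the s_i are involutions, each relation is
    equivalent to its braid form, in which two alternating words coincide.  This
    is a short computation for (s0, s1) and (s0, s2).  For the words of
    length six in s1 and s2, put u_0 = x, u_1 = y, u_2 = y - 1 and write b, a
    for beta1, beta2: the move of s1 adds b / z to all u_i, and that of s2
    subtracts a (1/u_0 + 1/u_1 + 1/u_2) from z.  Along the orbit all coordinates
    factor into tau functions, polynomials in v_i = u_i z and the parameters,
    and each move amounts to a bilinear relation between consecutive tau
    functions ([move2_tau], [move1_tau]).
    Both words then lead to the same products of tau functions
    ([braid12]). *)

(** * Values of rational functions at points *)

(** A ring morphism out of a polynomial ring is the evaluation at the images of
    the constants and of the indeterminates. *)
Lemma mpoly_morphE (n : nat) (F : fieldType) (S : comNzRingType)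
    (f : {rmorphism F -> S}) (h : 'I_n -> S)
    (g : {rmorphism {mpoly F[n]} -> S}) :
  (forall c, g c%:MP = f c) -> (forall i, g 'X_i = h i) ->
  forall q, g q = mmap f h q.
Proof.
move=> gC gX q; rewrite {1}[q]mpolyE rmorph_sum; apply: eq_bigr => m _.
rewrite -mul_mpolyC rmorphM gC mpolyXE_id rmorph_prod; congr (_ * _).
by apply: eq_bigr => i _; rewrite rmorphXn gX.
Qed.

Section Values.
Variables (n : nat) (F : fieldType).
Local Notation A := {mpoly F[n]}.
Local Notation L := {fraction {mpoly F[n]}}.

Lemma fractionP (f : L) : exists a d : A, d != 0 /\ f = tofrac a / tofrac d.
Proof.
elim/quotW: f => r; exists (frac r).1, (frac r).2.
split; first exact: denom_ratioP.
have d0 := denom_ratioP r.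
apply: (canRL (mulfK _)); first by rewrite tofrac_eq0.
unlock FracField.tofrac.
rewrite -[LHS](@FracField.pi_mul A) /FracField.mulf; apply/eqmodP.
by rewrite /= FracField.equivfE !numden_Ratio ?mulr1 ?oner_eq0 // mulrC.
Qed.

Section Point.
Variables (K : fieldType) (iota : {rmorphism F -> K}) (h : 'I_n -> K).
Local Notation ev := (mmap iota h).

(** Rational functions have no value by themselves at a point of a larger field;
    this relation replaces evaluation.  It is functional, and it is
    [takes_value] with the point given as a family. *)
Definition has_value (f : L) (v : K) : Prop :=
  exists a d : A, [/\ f = tofrac a / tofrac d, ev d != 0 & v = ev a / ev d].

Lemma has_value_uniq f v w : has_value f v -> has_value f w -> v = w.
Proof.
move=> [a [d [-> d0 ->]]] [a' [d' [E d'0 ->]]].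
have nz q : ev q != 0 -> tofrac q != 0 :> L.
  by apply: contraNN; rewrite tofrac_eq0 => /eqP->; rewrite rmorph0.
apply/eqP; rewrite eqr_div // -!rmorphM /=; apply/eqP; congr (ev _).
apply/eqP; rewrite -tofrac_eq !tofracM -eqr_div ?nz //; exact/eqP.
Qed.

Lemma has_value_eq f v w : w = v -> has_value f w -> has_value f v.
Proof. by move->. Qed.

Lemma has_value_poly (a : A) : has_value (tofrac a) (ev a).
Proof. by exists a, 1; rewrite !rmorph1 !divr1 oner_eq0. Qed.

Lemma has_valueC c : has_value (tofrac c%:MP) (iota c).
Proof. by rewrite -(mmapC h iota); apply: has_value_poly. Qed.

Lemma has_valueX i : has_value (tofrac 'X_i) (h i).
Proof.
have -> : h i = ev 'X_i by rewrite mmapX mmap1U.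
exact: has_value_poly.
Qed.

Lemma has_valueD f g v w :
  has_value f v -> has_value g w -> has_value (f + g) (v + w).
Proof.
move=> [a [d [-> d0 ->]]] [a' [d' [-> d'0 ->]]].
have nz q : ev q != 0 -> tofrac q != 0 :> L.
  by apply: contraNN; rewrite tofrac_eq0 => /eqP->; rewrite rmorph0.
exists (a * d' + a' * d), (d * d'); rewrite !rmorphM !rmorphD !rmorphM /=.
by rewrite -!addf_div ?nz // mulf_neq0.
Qed.

Lemma has_valueM f g v w :
  has_value f v -> has_value g w -> has_value (f * g) (v * w).
Proof.
move=> [a [d [-> d0 ->]]] [a' [d' [-> d'0 ->]]].
by exists (a * a'), (d * d'); rewrite !rmorphM /= !mulf_div mulf_neq0.
Qed.

Lemma has_valueV f v : v != 0 -> has_value f v -> has_value f^-1 v^-1.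
Proof.
move=> v0 [a [d [-> d0 E]]]; exists d, a; rewrite !invf_div E invf_div.
split=> //; apply: contraNneq v0 => a0; by rewrite E a0 mul0r.
Qed.

Lemma has_value0 : has_value 0 0.
Proof. by have := has_valueC 0; rewrite !rmorph0. Qed.

Lemma has_value_nat k : has_value k%:R k%:R.
Proof. by have := has_valueC k%:R; rewrite !rmorph_nat. Qed.

Lemma has_value1 : has_value 1 1.
Proof. exact: (has_value_nat 1). Qed.

Lemma has_value_neq0 f v : has_value f v -> v != 0 -> f != 0.
Proof.
by move=> fv; apply: contraNneq => f0; rewrite f0 in fv;
   apply/eqP; apply: has_value_uniq fv has_value0.
Qed.

Lemma has_valueN f v : has_value f v -> has_value (- f) (- v).
Proof.
move=> fv; rewrite -mulN1r -(mulN1r v); apply: has_valueM => //.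
by have := has_valueC (-1); rewrite !rmorphN1.
Qed.

Lemma has_valueB f g v w :
  has_value f v -> has_value g w -> has_value (f - g) (v - w).
Proof. by move=> fv gw; apply: has_valueD => //; apply: has_valueN. Qed.

End Point.

(** The function f (X_i - c) = a' / d' has a value r != 0 at some scalar point
    of the hyperplane X_i = c, so a' does not vanish identically there.  If
    f = a / d, then restricting a (X_i - c) d' = a' d to the hyperplane, which
    is done by substituting c for X_i, shows that d is zero on all of it. *)
Lemma pole_no_value (i : 'I_n) (c : F) (f : L) (q : 'I_n -> F) (r : F)
    (K : fieldType) (iota : {rmorphism F -> K}) (h : 'I_n -> K) (v : K) :
  q i = c -> r != 0 -> has_value idfun q (f * (tofrac 'X_i - tofrac c%:MP)) r ->
  has_value iota h f v -> h i != iota c.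
Proof.
move=> qi r0 [a' [d' [E' d'0 r_def]]] [a [d [E d0 _]]].
pose X j : A := if j == i then c%:MP else 'X_j.
pose sub : A -> A := mmap (@mpolyC n F) X.
have evsub (S : fieldType) (g : {rmorphism F -> S}) (k : 'I_n -> S) p :
    k i = g c -> mmap g k (sub p) = mmap g k p.
  move=> kc; pose G := GRing.RMorphism.clone _ _ (mmap g k \o sub) _.
  rewrite -[LHS]/(G p); apply: mpoly_morphE => [b|j] /=.
    by rewrite /sub !mmapC.
  rewrite /sub mmapX mmap1U /X; case: eqP => [->|_]; first by rewrite mmapC.
  by rewrite mmapX mmap1U.
apply: contraNneq d0 => hi.
have a'0 : sub a' != 0.
  apply: contraNneq r0 => sa'; rewrite r_def -(evsub _ idfun q a') ?qi //.
  by rewrite sa' rmorph0 mul0r.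
have nz p : p != 0 -> tofrac p != 0 :> L by rewrite tofrac_eq0.
have [d1|d1] := eqVneq d 0; first by rewrite d1 rmorph0.
have d'1 : d' != 0 by apply: contraNneq d'0 => ->; rewrite rmorph0.
have P : a * ('X_i - c%:MP) * d' = a' * d.
  apply/eqP; rewrite -tofrac_eq !rmorphM rmorphB /=.
  move: E'; rewrite E mulrAC => /eqP; rewrite eqr_div ?nz //.
have sub0 : sub ('X_i - c%:MP) = 0.
  by rewrite /sub rmorphB /= mmapC mmapX mmap1U /X eqxx subrr.
have := congr1 sub P; rewrite [LHS]rmorphM [X in X * _]rmorphM /= -/sub sub0.
rewrite mulr0 mul0r [sub (a' * d)]rmorphM => /esym/eqP.
rewrite mulf_eq0 (negPf a'0) /= => /eqP sd.
have sd0 : sub d = 0 := sd.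
by rewrite -(evsub _ iota h d) // sd0 rmorph0.
Qed.

(** * Automorphisms of a field of rational functions *)

Definition const_frac : {rmorphism F -> L} :=
  GRing.RMorphism.clone _ _ (@FracField.tofrac A \o @mpolyC n F) _.

Lemma frac_morph_ext (s s' : {rmorphism L -> L}) :
  (forall c : F, s (tofrac c%:MP) = s' (tofrac c%:MP)) ->
  (forall i, s (tofrac 'X_i) = s' (tofrac 'X_i)) -> s =1 s'.
Proof.
move=> sC sX f; have [a [d [_ ->]]] := fractionP f.
pose f0 := GRing.RMorphism.clone _ _ (s' \o const_frac) _.
pose G (t : {rmorphism L -> L}) : {rmorphism A -> L} :=
  GRing.RMorphism.clone _ _ (t \o @FracField.tofrac A) _.
have Gs : G s =1 G s'.
  pose h i := s' (tofrac 'X_i).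
  move=> q; rewrite (@mpoly_morphE n F L f0 h (G s)) //.
  by symmetry; apply: mpoly_morphE.
by rewrite !fmorph_div; congr (_ / _); apply: Gs.
Qed.

(** The hypothesis says that substituting h twice gives back the
    indeterminates.  If phi denotes the substitution morphism on polynomials,
    then the value of phi q at the point h is q, whence phi is injective; every
    fraction therefore has a value at the point h, and s maps it to this
    value. *)
Lemma involutive_substitution (h : 'I_n -> L) :
  (forall i, has_value const_frac h (h i) (tofrac 'X_i)) ->
  exists s : {rmorphism L -> L},
    [/\ forall c, s (tofrac c%:MP) = tofrac c%:MP,
        forall i, s (tofrac 'X_i) = h i & s \o s =1 id].
Proof.
move=> hK.
pose phi : {rmorphism A -> L} :=
  GRing.RMorphism.clone _ _ (mmap const_frac h) _.
have phi_val (q : A) : has_value const_frac h (phi q) (tofrac q).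
  rewrite [q in tofrac q]mpolyE rmorph_sum /= /mmap.
  apply: (big_ind2 (has_value const_frac h)); first exact: has_value0.
    by move=> *; apply: has_valueD.
  move=> m _; rewrite -mul_mpolyC rmorphM mpolyXE_id rmorph_prod /=.
  apply: has_valueM; first exact: has_valueC.
  apply: (big_ind2 (has_value const_frac h)); first exact: has_value1.
    by move=> *; apply: has_valueM.
  move=> i _; rewrite rmorphXn; elim: (m i) => [|k IH].
    by rewrite !expr0; apply: has_value1.
  by rewrite !exprS; apply: has_valueM.
have phi_inj q : q != 0 -> phi q != 0.
  apply: contraNneq => q0; rewrite -tofrac_eq0; apply/eqP.
  have := phi_val q; rewrite q0 => /has_value_uniq; apply; exact: has_value0.
have total f : exists v, has_value const_frac h f v.
  have [a [d [d0 ->]]] := fractionP f.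
  by exists (phi a / phi d), a, d; rewrite phi_inj.
have [s sP] := choice total.
have sE f v : has_value const_frac h f v -> s f = v by apply: has_value_uniq.
have sB : zmod_morphism s by move=> f g; apply: sE; apply: has_valueB.
have sM : monoid_morphism s.
  split; first by apply: sE; apply: has_value1.
  by move=> f g; apply: sE; apply: has_valueM.
pose s_add := GRing.isZmodMorphism.Build _ _ s sB.
pose s_mul := GRing.isMonoidMorphism.Build _ _ s sM.
pose S : {rmorphism L -> L} := HB.pack s s_add s_mul.
have SC c : S (tofrac c%:MP) = tofrac c%:MP.
  by apply: sE; apply: (has_valueC const_frac h).
have SX i : S (tofrac 'X_i) = h i by apply: sE; apply: has_valueX.
exists S; split=> //.
pose SS := GRing.RMorphism.clone _ _ (S \o S) _.
pose I := GRing.RMorphism.clone L L idfun _.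
apply: (@frac_morph_ext SS I) => [c|i] /=.
  exact: etrans (congr1 S (SC c)) (SC c).
by rewrite -[LHS]/(S (S (tofrac 'X_i))) SX; apply: sE.
Qed.
End Values.

(** * Invariance of the vector field *)

Section VectorField.
Variables (K : fieldType) (e b1 b2 x y z : K).
Let b0 : K := 1 - 2 * b1 - 3 * b2.

Definition restricted_P (b b' u v w : K) :=
  D4_P e (1 - 2 * b - 3 * b') b' b b' b' u v w.
Definition restricted_Q (b b' u v w : K) :=
  D4_Q e (1 - 2 * b - 3 * b') b' b b' b' u v w.
Definition restricted_R (b b' u v w : K) :=
  D4_R e (1 - 2 * b - 3 * b') b' b b' b' u v w.

Local Notation P := (restricted_P b1 b2 x y z).
Local Notation Q := (restricted_Q b1 b2 x y z).
Local Notation V := (restricted_R b1 b2 x y z).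

Lemma restricted_P_s0 : x - e != 0 ->
  restricted_P (b1 + b0) b2 x y (z - b0 / (x - e)) = P.
Proof. by move=> h; rewrite /restricted_P /D4_P /b0; field. Qed.

Lemma restricted_Q_s0 : x - e != 0 ->
  restricted_Q (b1 + b0) b2 x y (z - b0 / (x - e)) = Q.
Proof. by move=> h; rewrite /restricted_Q /D4_Q /b0; field. Qed.

(** Since z moves by - b0 / (x - e), its derivative gains b0 x' / (x - e)^2; the
    other identities of this section for moved coordinates have the same
    shape.  The equation for y carries a minus sign, hence the sign of Q
    below. *)
Lemma restricted_R_s0 : x - e != 0 ->
  restricted_R (b1 + b0) b2 x y (z - b0 / (x - e)) = V + b0 * P / (x - e) ^+ 2.
Proof.
by move=> h; rewrite /restricted_R /restricted_P /D4_R /D4_P /b0; field.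
Qed.

Lemma restricted_P_s1 : z != 0 ->
  restricted_P (- b1) (b2 + b1) (x + b1 / z) (y + b1 / z) z =
  P - b1 * V / z ^+ 2.
Proof.
by move=> h; rewrite /restricted_P /restricted_R /D4_P /D4_R; field.
Qed.

Lemma restricted_Q_s1 : z != 0 ->
  restricted_Q (- b1) (b2 + b1) (x + b1 / z) (y + b1 / z) z =
  Q + b1 * V / z ^+ 2.
Proof.
by move=> h; rewrite /restricted_Q /restricted_R /D4_Q /D4_R; field.
Qed.

Lemma restricted_R_s1 : z != 0 ->
  restricted_R (- b1) (b2 + b1) (x + b1 / z) (y + b1 / z) z = V.
Proof. by move=> h; rewrite /restricted_R /D4_R; field. Qed.

Section S2.
Hypotheses (x0 : x != 0) (y0 : y != 0) (w0 : y - 1 != 0).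
Let z' :=
  z - b2 * (y * (y - 1) + x * (y - 1) + x * y) / (x * y * (y - 1)).

Lemma restricted_P_s2 : restricted_P (b1 + 3 * b2) (- b2) x y z' = P.
Proof. by rewrite /restricted_P /D4_P /z'; field; rewrite x0 y0 w0. Qed.

Lemma restricted_Q_s2 : restricted_Q (b1 + 3 * b2) (- b2) x y z' = Q.
Proof. by rewrite /restricted_Q /D4_Q /z'; field; rewrite x0 y0 w0. Qed.

Lemma restricted_R_s2 : restricted_R (b1 + 3 * b2) (- b2) x y z' =
  V + b2 * (P / x ^+ 2 - Q / y ^+ 2 - Q / (y - 1) ^+ 2).
Proof.
rewrite /restricted_R /restricted_P /restricted_Q /D4_P /D4_Q /D4_R /z'.
by field; rewrite x0 y0 w0.
Qed.
End S2.
End VectorField.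

(** * Transformation of solutions in a differential field *)

Section Solutions.
Variables (R : realType) (eta : R[i]) (b : ratC R).
Variables (K : fieldType) (iota : {rmorphism ratC R -> K}) (D : K -> K).
Hypothesis ext : extends_ddt iota D.

Definition constants : {rmorphism R[i] -> K} :=
  GRing.RMorphism.clone _ _
    (iota \o (@FracField.tofrac {poly R[i]} \o @polyC R[i])) _.
Local Notation c := constants.

Lemma D_sub r s : D (r - s) = D r - D s.
Proof.
by case: ext => DD _ _ _; apply/eqP; rewrite eq_sym subr_eq -DD subrK.
Qed.

Lemma D_const a : D (c a) = 0.
Proof. by case: ext => _ _ Dc _; apply: Dc. Qed.

Lemma D_const_div (a : R[i]) (v : K) : v != 0 ->
  D (c a / v) = - (c a * D v / v ^+ 2).
Proof.
move=> v0; case: ext => _ DM _ _.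
have : D (c a / v * v) = 0 by rewrite divfK // D_const.
rewrite DM => /eqP; rewrite addr_eq0 => /eqP E.
have -> : D (c a / v) = (D (c a / v) * v) / v by rewrite mulfK.
by rewrite E; field.
Qed.

Lemma D_add u v : D (u + v) = D u + D v.
Proof. by case: ext. Qed.

Lemma const_beta0 (b0 b1 b2 : R[i]) : b0 + b2 + 2 * b1 + b2 + b2 = 1 ->
  c b0 = 1 - 2 * c b1 - 3 * c b2.
Proof.
move=> sum.
have -> : b0 = (b0 + b2 + 2 * b1 + b2 + b2) - 2 * b1 - 3 * b2 by ring.
by rewrite sum !rmorphB !rmorphM !rmorph_nat rmorph1.
Qed.

Lemma restrictedE b0 b1 b2 x y z :
  restricted_D4_system eta b iota D b0 b1 b2 x y z <->
  let k := 2 * c eta / iota b in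
  [/\ b0 + b2 + 2 * b1 + b2 + b2 = 1,
      k * D x = restricted_P (c eta) (c b1) (c b2) x y z,
      - k * D y = restricted_Q (c eta) (c b1) (c b2) x y z &
      k * D z = restricted_R (c eta) (c b1) (c b2) x y z].
Proof.
split=> -[sum]; have := const_beta0 sum;
  rewrite /restricted_P /restricted_Q /restricted_R.
  by move=> <-; split.
by move=> <-; split.
Qed.

Lemma s0_solution b0 b1 b2 x y z : x - c eta != 0 ->
  restricted_D4_system eta b iota D b0 b1 b2 x y z ->
  restricted_D4_system eta b iota D (- b0) (b1 + b0) b2 x y
    (z - c b0 / (x - c eta)).
Proof.
move=> xe /restrictedE[sum eP eQ eR]; apply/restrictedE.
rewrite rmorphD (const_beta0 sum).
split; first by apply: etrans sum; ring.
- by rewrite restricted_P_s0.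
- by rewrite restricted_Q_s0.
rewrite restricted_R_s0 // -eR -eP -(const_beta0 sum).
rewrite D_sub D_const_div // opprK D_sub D_const subr0.
by ring.
Qed.

Lemma s1_solution b0 b1 b2 x y z : z != 0 ->
  restricted_D4_system eta b iota D b0 b1 b2 x y z ->
  restricted_D4_system eta b iota D (b0 + b1) (- b1) (b2 + b1)
    (x + c b1 / z) (y + c b1 / z) z.
Proof.
move=> z0 /restrictedE[sum eP eQ eR]; apply/restrictedE.
rewrite rmorphD rmorphN.
split; first by apply: etrans sum; ring.
- rewrite restricted_P_s1 // -eR -eP.
  by rewrite D_add D_const_div //; ring.
- rewrite restricted_Q_s1 // -eR -eQ.
  by rewrite D_add D_const_div //; ring.
- by rewrite restricted_R_s1.
Qed.

Lemma s2_solution b0 b1 b2 x y z : x != 0 -> y != 0 -> y - 1 != 0 ->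
  restricted_D4_system eta b iota D b0 b1 b2 x y z ->
  restricted_D4_system eta b iota D b0 (b1 + 3 * b2) (- b2) x y
    (z - c b2 * (y * (y - 1) + x * (y - 1) + x * y) / (x * y * (y - 1))).
Proof.
move=> x0 y0 w0 /restrictedE[sum eP eQ eR]; apply/restrictedE.
rewrite rmorphD rmorphM rmorph_nat rmorphN.
split; first by apply: etrans sum; ring.
- by rewrite restricted_P_s2.
- by rewrite restricted_Q_s2.
rewrite restricted_R_s2 // -eR -eP -eQ.
rewrite (_ : c b2 * _ / _ = c b2 / x + c b2 / y + c b2 / (y - 1)); last first.
  by field; rewrite x0 y0 w0.
have D1 : D 1 = 0 by rewrite -(rmorph1 c) D_const.
rewrite D_sub !D_add !D_const_div // D_sub D1.
by move: (_ / iota b) => k; field; rewrite x0 y0 w0.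
Qed.
End Solutions.

(** * Moves on points, and the braid relation of s1 and s2 *)

Section Moves.
Variable K : fieldType.
Implicit Types (x y z a b : K) (p : K * K * K * K * K).

(** The components of a point are x, y, z, beta1, beta2, in this order. *)
Definition move1 p :=
  let: (x, y, z, b, a) := p in (x + b / z, y + b / z, z, - b, a + b).
Definition move2 p :=
  let: (x, y, z, b, a) := p in
  (x, y, z - a * (y * (y - 1) + x * (y - 1) + x * y) / (x * y * (y - 1)),
   b + 3 * a, - a).
Definition regular p :=
  let: (x, y, z, _, _) := p in [&& x != 0, y != 0, y - 1 != 0 & z != 0].

(** Shapes of the points of an orbit.  Here z is the initial third coordinate,
    S, T, T' are consecutive tau functions of one family, and (A_0, A_1, A_2),
    (B_0, B_1, B_2) are consecutive triples, with an index for each of x, y,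
    y - 1.  The move of s2 keeps the first two coordinates and replaces
    T S / (A_0 A_1 A_2) by T T' / (B_0 B_1 B_2) in the third; the move of s1
    keeps the third and replaces A_i B_i / T by B_i C_i / T' in the others. *)
Definition before_move2 z S T b a A0 A1 A2 B0 B1 :=
  (A0 * B0 / (z * T), A1 * B1 / (z * T), z * T * S / (A0 * A1 * A2), b, a).
Definition before_move1 z T T' b a A0 A1 B0 B1 B2 :=
  (A0 * B0 / (z * T), A1 * B1 / (z * T), z * T * T' / (B0 * B1 * B2), b, a).

(** The first hypothesis says that y - 1 has the same shape as x and y, with
    index 2.  Over a common denominator, the move of s2 then becomes the second
    hypothesis. *)
Lemma move2_tau (z S T T' b a A0 A1 A2 B0 B1 B2 : K) :
  A1 * B1 - A2 * B2 = z * T ->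
  S * (B0 * B1 * B2)
    - a * (A0 * A1 * B0 * B1 + A0 * A2 * B0 * B2 + A1 * A2 * B1 * B2) =
  A0 * A1 * A2 * T' ->
  regular (before_move2 z S T b a A0 A1 A2 B0 B1) ->
  move2 (before_move2 z S T b a A0 A1 A2 B0 B1) =
  before_move1 z T T' (b + 3 * a) (- a) A0 A1 B0 B1 B2.
Proof.
move=> AB bil /and4P[]; rewrite !mulf_eq0 !invr_eq0 !mulf_eq0 !negb_or.
case/and3P=> /andP[A00 B00] z0 T0 /and3P[/andP[A10 B10] _ _] Y.
case/andP=> /andP[_ S0] /andP[_ A20].
have zT0 : z * T != 0 by rewrite mulf_neq0.
have yE : A1 * B1 / (z * T) - 1 = A2 * B2 / (z * T).
  by rewrite -[1](divff zT0) -mulrBl -AB; congr (_ / _); ring.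
have B20 : B2 != 0.
  by move: Y; rewrite yE !mulf_eq0 !negb_or => /andP[/andP[]].
rewrite /before_move2 /before_move1 /move2 yE; congr (_, _, _, _, _).
have -> : T' =
  (S * (B0 * B1 * B2)
   - a * (A0 * A1 * B0 * B1 + A0 * A2 * B0 * B2 + A1 * A2 * B1 * B2))
  / (A0 * A1 * A2).
  by rewrite bil mulrC mulKf // !mulf_neq0.
by field; rewrite !(A00, A10, A20, B00, B10, B20, z0, T0).
Qed.

Lemma move1_tau (z T T' b a A0 A1 B0 B1 B2 C0 C1 : K) :
  A0 * T' + b * (B1 * B2) = T * C0 ->
  A1 * T' + b * (B0 * B2) = T * C1 ->
  regular (before_move1 z T T' b a A0 A1 B0 B1 B2) ->
  move1 (before_move1 z T T' b a A0 A1 B0 B1 B2) =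
  before_move2 z T T' (- b) (a + b) B0 B1 B2 C0 C1.
Proof.
move=> bil0 bil1 /and4P[]; rewrite !mulf_eq0 !invr_eq0 !mulf_eq0 !negb_or.
case/and3P=> /andP[A00 B00] z0 T0 /and3P[/andP[A10 B10] _ _] _.
case/andP=> /andP[_ T'0] /andP[_ B20].
rewrite /before_move2 /before_move1 /move1; congr (_, _, _, _, _).
- have -> : C0 = (A0 * T' + b * (B1 * B2)) / T by rewrite bil0 mulrC mulKf.
  by field; rewrite !(A00, A10, B00, B10, B20, z0, T0, T'0).
- have -> : C1 = (A1 * T' + b * (B0 * B2)) / T by rewrite bil1 mulrC mulKf.
  by field; rewrite !(A00, A10, B00, B10, B20, z0, T0, T'0).
- by field; rewrite !(A00, A10, B00, B10, B20, z0, T0, T'0).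
Qed.

(** The tau functions, in the variables v0 = x z, v1 = y z, v2 = (y - 1) z.  The
    first two steps of the orbit produce [tau1] and [rho]; [tau2] and [sigma]
    are the exact quotients that [move2_tau] and [move1_tau] require at the next
    two steps.  The triples consist of the values of [rho] and [sigma] with each
    variable in turn as the distinguished first one. *)
Definition tau1 b a v0 v1 v2 : K :=
  v0 * v1 * v2 - a * (v0 * v1 + v0 * v2 + v1 * v2).
Definition rho b a v0 v1 v2 :=
  tau1 b a v0 v1 v2 + (b + 3 * a) * (v1 * v2).
Definition tau2 b a v0 v1 v2 :=
  tau1 b a v0 v1 v2 ^+ 2
  - (b + 3 * a) * (a + b) * (v0 + v1 + v2) * tau1 b a v0 v1 v2
  - (b + 3 * a) ^+ 2 * (2 * b + 3 * a) * (v0 * v1 * v2).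
Definition sigma b a v0 v1 v2 :=
  v0 * tau1 b a v0 v1 v2 - (b + 3 * a) * (a + b) * (v0 + v1 + v2) * v0
  + (2 * b + 3 * a) * tau1 b a v0 v1 v2
  + (2 * b + 3 * a) * (b + 3 * a) * v0 * (v1 + v2).

Section Orbit.
Variables (z b a v0 v1 v2 : K).
Hypothesis z_def : v1 - v2 = z.
Let t1 := tau1 b a v0 v1 v2.
Let t2 := tau2 b a v0 v1 v2.
Let t3 := tau2 (- b) (a + b) (v0 + b) (v1 + b) (v2 + b).
Let p0 := rho b a v0 v1 v2.
Let p1 := rho b a v1 v0 v2.
Let p2 := rho b a v2 v0 v1.
Let q0 := sigma b a v0 v1 v2.
Let q1 := sigma b a v1 v0 v2.
Let q2 := sigma b a v2 v0 v1.

(** The last tau function, t3, is [tau2] at the point obtained by the move of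
    s1, where z is unchanged and b is added to every v_i: the orbits starting
    with s1 and with s2 meet t2 and t3 in opposite orders. *)
Lemma five_moves :
  let p := (v0 / z, v1 / z, z, b, a) in
  regular p -> regular (move2 p) -> regular (move1 (move2 p)) ->
  regular (move2 (move1 (move2 p))) ->
  regular (move1 (move2 (move1 (move2 p)))) ->
  move2 (move1 (move2 (move1 (move2 p)))) =
  before_move1 z t2 t3 b (- (a + b)) p0 p1 q0 q1 q2.
Proof.
(* At the start the earlier tau functions are all 1. *)
have -> : (v0 / z, v1 / z, z, b, a) = before_move2 z 1 1 b a 1 1 1 v0 v1.
  by rewrite /before_move2 !mul1r !mulr1 divr1.
move=> p; rewrite /p.
have E1 : 1 * v1 - 1 * v2 = z * 1 by rewrite !mul1r mulr1.
move=> g; rewrite (@move2_tau z 1 1 t1 b a 1 1 1 v0 v1 v2) // {g p}; last first.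
  by rewrite /t1 /tau1; ring.
move=> g; rewrite (@move1_tau _ _ _ _ _ _ _ _ _ _ p0 p1) // {g}; last 2 first.
- by rewrite /p0 /rho -/t1; ring.
- by rewrite /p1 /rho /t1 /tau1; ring.
move=> g; rewrite (@move2_tau _ _ _ t2 _ _ _ _ _ _ _ p2) // {g}; last 2 first.
- by rewrite /p1 /p2 /t1 -z_def /rho /tau1; ring.
- by rewrite /p0 /p1 /p2 /t2 /tau2 /t1 /rho /tau1; ring.
move=> g; rewrite (@move1_tau _ _ _ _ _ _ _ _ _ _ q0 q1) // {g}; last 2 first.
- by rewrite /p0 /p1 /p2 /t2 /q0 /t1 /sigma /tau2 /rho /tau1; ring.
- by rewrite /p0 /p1 /p2 /t2 /q1 /t1 /sigma /tau2 /rho /tau1; ring.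
move=> g; rewrite (@move2_tau _ _ _ t3 _ _ _ _ _ _ _ q2) // {g}; last 2 first.
- by rewrite /p0 /p1 /p2 /t2 /q1 /q2 -z_def /sigma /tau2 /rho /tau1; ring.
- by rewrite /p0 /p1 /p2 /q0 /q1 /q2 /t1 /t3 /sigma /tau2 /rho /tau1; ring.
congr (before_move1 _ _ _ _ _ _ _ _ _ _); ring.
Qed.
End Orbit.

(** [five_moves] applies to p and to its image under the move of s1.  One more
    move of s1 from the first end point gives the second one, because [sigma]
    takes the same values at p and at its image, while t2 and t3 are
    exchanged. *)
Lemma braid12 p :
  let p1 := move1 p in let p2 := move2 p in
  regular p -> regular p1 -> regular (move2 p1) ->
  regular (move1 (move2 p1)) -> regular (move2 (move1 (move2 p1))) ->
  regular (move1 (move2 (move1 (move2 p1)))) ->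
  regular p2 -> regular (move1 p2) -> regular (move2 (move1 p2)) ->
  regular (move1 (move2 (move1 p2))) ->
  regular (move2 (move1 (move2 (move1 p2)))) ->
  move2 (move1 (move2 (move1 (move2 (move1 p))))) =
  move1 (move2 (move1 (move2 (move1 (move2 p))))).
Proof.
case: p => [[[[x y] z] b] a] q1 q2 g.
have /and4P[x0 y0 w0 z0] := g.
pose v0 := x * z; pose v1 := y * z; pose v2 := (y - 1) * z.
have q0E : (x, y, z, b, a) = (v0 / z, v1 / z, z, b, a).
  by rewrite /v0 /v1 !mulfK.
have zE : v1 - v2 = z by rewrite /v1 /v2; ring.
have q1E : q1 = ((v0 + b) / z, (v1 + b) / z, z, - b, a + b).
  by rewrite /q1 q0E /move1 -!mulrDl.
have zE1 : (v1 + b) - (v2 + b) = z by rewrite -zE; ring.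
rewrite /q2 -/q1 q1E q0E in g *.
move=> g1 g2 g3 g4 g5 h1 h2 h3 h4 h5.
rewrite (five_moves zE1) // (five_moves zE) // in h5 *.
pose t v v' v'' := rho (- b) (a + b) (v + b) (v' + b) (v'' + b).
rewrite (@move1_tau _ _ _ _ _ _ _ _ _ _ (t v0 v1 v2) (t v1 v0 v2)) //;
  last 2 first.
- by rewrite /t /rho /sigma /tau2 /rho /tau1; ring.
- by rewrite /t /rho /sigma /tau2 /rho /tau1; ring.
rewrite /before_move2 /before_move1.
congr (_, _, _, _, _).
all: try congr (_ / _).
all: rewrite /t /sigma /tau2 /rho /tau1; ring.
Qed.
End Moves.

(** * The relations involving s0 *)

Section Move0.
Variable K : fieldType.

Definition move0 (e : K) (p : K * K * K * K * K) :=
  let: (x, y, z, b, a) := p in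
  (x, y, z - (1 - 2 * b - 3 * a) / (x - e), b + (1 - 2 * b - 3 * a), a).

Lemma braid01 (e : K) p :
  let off (q : K * K * K * K * K) := q.1.1.1.1 - e != 0 in
  let p0 := move0 e p in let p1 := move1 p in
  off p -> off (move1 p0) -> off p1 ->
  regular p -> regular p0 -> regular (move0 e p1) ->
  move0 e (move1 (move0 e p)) = move1 (move0 e (move1 p)).
Proof.
case: p => [[[[x y] z] b] a] /=.
pose c := 1 - 2 * b - 3 * a.
have E1 : 1 - 2 * - (b + c) - 3 * (a + (b + c)) = b by rewrite /c; ring.
have E2 : 1 - 2 * - b - 3 * (a + b) = b + c by rewrite /c; ring.
rewrite -/c E1 E2.
move=> u0 u1 u2 /and4P[_ _ _ z0] /and4P[_ _ _ z1] /and4P[_ _ _ z2].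
have n0 : z * (x - e) - c != 0.
  by apply: contraNneq z1 => n0; rewrite -[z](mulfK u0) -mulrBl n0 mul0r.
have n1 : z * (x - e) + b != 0.
  apply: contraNneq u2 => n1.
  by rewrite addrAC -[x - e](mulfK z0) -mulrDl mulrC (mulrC _ z) n1 mulr0.
(* Factorizations of the denominators that arise from expanding both sides. *)
have n2 : x * z + b + - e * z != 0.
  by rewrite (_ : _ + _ = z * (x - e) + b) //; ring.
have n3 : z * (x * z + b + - e * z) - (b + c) * z != 0.
  by rewrite (_ : _ - _ = z * (z * (x - e) - c)) ?mulf_neq0 //; ring.
have n4 :
    x * (z * (x - e) - c) + (b + c) * (x - e) + - e * (z * (x - e) - c) != 0.
  rewrite (_ : _ + _ = (x - e) * (z * (x - e) + b)) ?mulf_neq0 //; ring.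
by congr (_, _, _, _, _); field; rewrite ?z0 ?u0 ?n0 ?n2 ?n3 ?n4.
Qed.

Lemma commute02 (e : K) p :
  move0 e (move2 p) = move2 (move0 e p).
Proof.
case: p => [[[[x y] z] b] a] /=.
rewrite (_ : 1 - 2 * (b + 3 * a) - 3 * - a = 1 - 2 * b - 3 * a); last by ring.
by congr (_, _, _, _, _); ring.
Qed.

End Move0.

(** * From braid relations to powers *)

Lemma iter_braid2 (T : Type) (s t : T -> T) :
  s \o s =1 id -> t \o t =1 id ->
  (forall u, s (t u) = t (s u)) -> iter 2 (s \o t) =1 id.
Proof.
move=> ss tt st u.
have S v : s (s v) = v := ss v; have T' v : t (t v) = v := tt v.
by rewrite /= st S T'.
Qed.

Lemma iter_braid3 (T : Type) (s t : T -> T) :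
  s \o s =1 id -> t \o t =1 id ->
  (forall u, s (t (s u)) = t (s (t u))) -> iter 3 (s \o t) =1 id.
Proof.
move=> ss tt st u.
have S v : s (s v) = v := ss v; have T' v : t (t v) = v := tt v.
by rewrite /= st T' S T'.
Qed.

Lemma iter_braid6 (T : Type) (s t : T -> T) :
  s \o s =1 id -> t \o t =1 id ->
  (forall u, s (t (s (t (s (t u))))) = t (s (t (s (t (s u)))))) ->
  iter 6 (s \o t) =1 id.
Proof.
move=> ss tt st u.
have S v : s (s v) = v := ss v; have T' v : t (t v) = v := tt v.
by rewrite /= st S T' S T' S T'.
Qed.

(** * Coordinates of the function field *)

(** These identities are stated over an arbitrary field because computing in
    the function field itself would unfold the construction of fractions. *)
Section FieldIdentities.
Variable K : fieldType.
Implicit Types x y z u v w a b : K.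

Lemma s0_involutive_z z u b a :
  z - (1 - 2 * b - 3 * a) / u
  - (1 - 2 * (b + (1 - 2 * b - 3 * a)) - 3 * a) / u = z.
Proof.
rewrite (_ : 1 - 2 * (b + _) - _ = - (1 - 2 * b - 3 * a)).
  by rewrite mulNr opprK subrK.
by ring.
Qed.

Lemma s0_involutive_beta1 b a :
  b + (1 - 2 * b - 3 * a) + (1 - 2 * (b + (1 - 2 * b - 3 * a)) - 3 * a) = b.
Proof. by ring. Qed.

Lemma s2_involutive_z z a u v : z - a * u / v - (- a) * u / v = z.
Proof. by rewrite !mulNr opprK subrK. Qed.

Lemma s2_involutive_beta1 b a : b + 3 * a + 3 * - a = b.
Proof. by rewrite mulrN addrK. Qed.

Lemma s1_involutive_x x b z : x + b / z + (- b) / z = x.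
Proof. by rewrite mulNr addrK. Qed.

Lemma s0_beta0 b a :
  1 - 2 * (b + (1 - 2 * b - 3 * a)) - 3 * a = - (1 - 2 * b - 3 * a).
Proof. by ring. Qed.

Lemma s1_beta0 b a : 1 - 2 * - b - 3 * (a + b) = 1 - 2 * b - 3 * a + b.
Proof. by ring. Qed.

Lemma s2_beta0 b a : 1 - 2 * (b + 3 * a) - 3 * - a = 1 - 2 * b - 3 * a.
Proof. by ring. Qed.

Lemma clear_pole_s0 z b u : u != 0 -> (z - b / u) * u = z * u - b.
Proof. by move=> u0; rewrite mulrBl divfK. Qed.

Lemma clear_pole_s1 x b z : z != 0 -> (x + b / z) * (z - 0) = x * z + b.
Proof. by move=> z0; rewrite subr0 mulrDl divfK. Qed.

Section S2.
Variables (z b x y w : K).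
Hypotheses (x0 : x != 0) (y0 : y != 0) (w0 : w != 0).
Let z' := z - b * (y * w + x * w + x * y) / (x * y * w).

Lemma clear_pole_s2_x : z' * (x - 0) = z * x - b * (1 + x / y + x / w).
Proof. by rewrite /z'; field; rewrite x0 y0 w0. Qed.

Lemma clear_pole_s2_y : z' * (y - 0) = z * y - b * (1 + y / x + y / w).
Proof. by rewrite /z'; field; rewrite x0 y0 w0. Qed.

Lemma clear_pole_s2_w : z' * w = z * w - b * (1 + w / x + w / y).
Proof. by rewrite /z'; field; rewrite x0 y0 w0. Qed.
End S2.

(** Values of cleared functions on the polar divisor, where the coordinate c
    vanishes, at beta = (1, 0, 0) for s0 and at beta2 = 1 for s2. *)
Lemma residue_s0_neq0 z c : c = 0 -> z * c - (1 - 2 * 0 - 3 * 0) != 0.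
Proof. by move=> ->; rewrite !mulr0 !subr0 sub0r oppr_eq0 oner_neq0. Qed.

Lemma residue_s2_neq0 z c u v : c = 0 -> z * c - 1 * (1 + c / u + c / v) != 0.
Proof.
by move=> ->; rewrite mulr0 !mul0r !addr0 mul1r sub0r oppr_eq0 oner_neq0.
Qed.
End FieldIdentities.

Lemma forall_ord5 (P : 'I_5 -> Prop) :
  P (@Ordinal 5 0 isT) -> P (@Ordinal 5 1 isT) -> P (@Ordinal 5 2 isT) ->
  P (@Ordinal 5 3 isT) -> P (@Ordinal 5 4 isT) -> forall i, P i.
Proof.
move=> P0 P1 P2 P3 P4 i.
by case: i => -[|[|[|[|[|//]]]]] lti;
  [move: P0|move: P1|move: P2|move: P3|move: P4]; congr P; apply: val_inj.
Qed.

Section Coordinates.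
Variable R : realType.
Local Notation F := (ratC R).
Local Notation val iota p := (@has_value 5 F _ iota (tnth p)).

Variables (K : fieldType) (iota : {rmorphism F -> K}) (x y z b1 b2 : K).
Local Notation p := [tuple x; y; z; b1; b2].

Lemma val_x : val iota p (ff_x R) x. Proof. exact: has_valueX. Qed.
Lemma val_y : val iota p (ff_y R) y. Proof. exact: has_valueX. Qed.
Lemma val_z : val iota p (ff_z R) z. Proof. exact: has_valueX. Qed.
Lemma val_b1 : val iota p (ff_beta1 R) b1. Proof. exact: has_valueX. Qed.
Lemma val_b2 : val iota p (ff_beta2 R) b2. Proof. exact: has_valueX. Qed.
Lemma val_c c : val iota p (ff_scalar c) (iota c).
Proof. exact: has_valueC. Qed.
Lemma val_b0 : val iota p (ff_beta0 R) (1 - 2 * b1 - 3 * b2).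
Proof.
apply: has_valueB; last first.
  by apply: has_valueM; [exact: has_value_nat | exact: val_b2].
apply: has_valueB; first exact: has_value1.
by apply: has_valueM; [exact: has_value_nat | exact: val_b1].
Qed.
End Coordinates.

(** Reads off the value of a rational expression in the coordinates, up to the
    nonvanishing of its denominators. *)
Ltac values := repeat match goal with
  | |- has_value _ _ (ff_x _) _ => exact: val_x
  | |- has_value _ _ (ff_y _) _ => exact: val_y
  | |- has_value _ _ (ff_z _) _ => exact: val_z
  | |- has_value _ _ (ff_beta0 _) _ => exact: val_b0
  | |- has_value _ _ (ff_beta1 _) _ => exact: val_b1
  | |- has_value _ _ (ff_beta2 _) _ => exact: val_b2
  | |- has_value _ _ (ff_scalar _) _ => exact: val_c
  | |- has_value _ _ 1 _ => exact: has_value1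
  | |- has_value _ _ (_%:R) _ => exact: has_value_nat
  | |- has_value _ _ (_ + _) _ => apply: has_valueD
  | |- has_value _ _ (- _) _ => apply: has_valueN
  | |- has_value _ _ (_ * _) _ => apply: has_valueM
  | |- has_value _ _ (_^-1) _ => apply: has_valueV
  end.

Section Generators.
Variable R : realType.
Local Notation F := (ratC R).
Local Notation FF := (function_field R).
Local Notation X := (ff_x R).
Local Notation Y := (ff_y R).
Local Notation Z := (ff_z R).
Local Notation B0 := (ff_beta0 R).
Local Notation B1 := (ff_beta1 R).
Local Notation B2 := (ff_beta2 R).
Local Notation val iota p := (@has_value 5 F _ iota (tnth p)).

Definition fixes_scalars (s : {rmorphism FF -> FF}) :=
  forall c, s (ff_scalar c) = ff_scalar c.

Lemma involution_ext (X' Y' Z' B1' B2' : FF) :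
  let p := [tuple X'; Y'; Z'; B1'; B2'] in
  let iota := const_frac 5 F in
  [/\ val iota p X' X, val iota p Y' Y, val iota p Z' Z, val iota p B1' B1
    & val iota p B2' B2] ->
  exists s : {rmorphism FF -> FF},
    [/\ coordinate_images s = (X', Y', Z', 1 - 2 * B1' - 3 * B2', B1', B2'),
        fixes_scalars s & s \o s =1 id].
Proof.
move=> p iota [hX hY hZ h1 h2].
have [|s [sC sX ss]] := @involutive_substitution 5 F (tnth p).
  exact: forall_ord5.
exists s; split=> //; rewrite /coordinate_images /ff_beta0.
rewrite !rmorphB !rmorphM rmorph1 !rmorph_nat.
have E0 := sX (@Ordinal 5 0 isT); have E1 := sX (@Ordinal 5 1 isT).
have E2 := sX (@Ordinal 5 2 isT).
have E3 := sX (@Ordinal 5 3 isT); have E4 := sX (@Ordinal 5 4 isT).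
by congr (_, _, _, _ - _ * _ - _ * _, _, _).
Qed.

Lemma coordinate_ext (s s' : {rmorphism FF -> FF}) :
  (forall c, s (ff_scalar c) = s' (ff_scalar c)) ->
  s X = s' X -> s Y = s' Y -> s Z = s' Z -> s B1 = s' B1 -> s B2 = s' B2 ->
  s =1 s'.
Proof.
by move=> sC sX sY sZ s1 s2; apply: frac_morph_ext => //; apply: forall_ord5.
Qed.

Section Nonzero.
Let neq0 f v x y z b1 b2
    (fv : val (@idfun F) [tuple x; y; z; b1; b2] f v) :=
  has_value_neq0 fv.

Lemma X_neq0 : X != 0.
Proof. apply: (@neq0 _ 1 1 0 0 0 0); [values|exact: oner_neq0]. Qed.
Lemma Y_neq0 : Y != 0.
Proof. apply: (@neq0 _ 1 0 1 0 0 0); [values|exact: oner_neq0]. Qed.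
Lemma Z_neq0 : Z != 0.
Proof. apply: (@neq0 _ 1 0 0 1 0 0); [values|exact: oner_neq0]. Qed.
Lemma Y1_neq0 : Y - 1 != 0.
Proof.
apply: (@neq0 _ _ 0 0 0 0 0); first by values.
by rewrite sub0r oppr_eq0 oner_neq0.
Qed.

Lemma Xe_neq0 (c : F) : X - ff_scalar c != 0.
Proof.
apply: (@neq0 _ _ (1 + c) 0 0 0 0); first by values.
by rewrite addrK oner_neq0.
Qed.
End Nonzero.

Variable eta : R[i].
Local Notation e := (ff_scalar (ratC_const eta)).

(** * Existence of the generators *)

Lemma s0_exists : exists s : {rmorphism FF -> FF},
    [/\ coordinate_images s = (X, Y, Z - B0 / (X - e), - B0, B1 + B0, B2),
        fixes_scalars s & s \o s =1 id].
Proof.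
have xe := Xe_neq0 (ratC_const eta).
have [|s [si sC ss]] := @involution_ext X Y (Z - B0 / (X - e)) (B1 + B0) B2.
  split; try by values.
  - apply: has_value_eq (s0_involutive_z Z (X - e) B1 B2) _.
    by values; exact: xe.
  - by apply: has_value_eq (s0_involutive_beta1 B1 B2) _; values.
exists s; split=> //; rewrite si; congr (_, _, _, _, _, _); exact: s0_beta0.
Qed.

Lemma s1_exists : exists s : {rmorphism FF -> FF},
    [/\ coordinate_images s =
          (X + B1 / Z, Y + B1 / Z, Z, B0 + B1, - B1, B2 + B1),
        fixes_scalars s & s \o s =1 id].
Proof.
have z0 := Z_neq0.
have [|s [si sC ss]] :=
  @involution_ext (X + B1 / Z) (Y + B1 / Z) Z (- B1) (B2 + B1).
  split; try by values.
  - by apply: has_value_eq (s1_involutive_x X B1 Z) _; values.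
  - by apply: has_value_eq (s1_involutive_x Y B1 Z) _; values.
  - by apply: has_value_eq (opprK B1) _; values.
  - by apply: has_value_eq (addrK B1 B2) _; values.
exists s; split=> //; rewrite si; congr (_, _, _, _, _, _); exact: s1_beta0.
Qed.

Lemma s2_exists : exists s : {rmorphism FF -> FF},
    [/\ coordinate_images s =
          (X, Y,
           Z - B2 * (Y * (Y - 1) + X * (Y - 1) + X * Y) / (X * Y * (Y - 1)),
           B0, B1 + 3 * B2, - B2),
        fixes_scalars s & s \o s =1 id].
Proof.
have x0 := X_neq0; have y0 := Y_neq0; have y1 := Y1_neq0.
have d0 := mulf_neq0 (mulf_neq0 x0 y0) y1.
set Z' := Z - _.
have [|s [si sC ss]] := @involution_ext X Y Z' (B1 + 3 * B2) (- B2).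
  split; try by values.
  - pose n := Y * (Y - 1) + X * (Y - 1) + X * Y.
    apply: has_value_eq (s2_involutive_z Z B2 n (X * Y * (Y - 1))) _.
    by rewrite /Z' /n; values.
  - by apply: has_value_eq (s2_involutive_beta1 B1 B2) _; values.
  - by apply: has_value_eq (opprK B2) _; values.
exists s; split=> //; rewrite si; congr (_, _, _, _, _, _); exact: s2_beta0.
Qed.

(** * The generators preserve the system *)

Lemma scalar0 : ff_scalar (0 : F) = 0.
Proof. by rewrite /ff_scalar mpolyC0 tofrac0. Qed.

Lemma scalar1 : ff_scalar (1 : F) = 1.
Proof. by rewrite /ff_scalar mpolyC1 tofrac1. Qed.

Lemma two_neq0 : 1 + 1 != 0 :> F.
Proof.
have -> : 1 + 1 = constants (@idfun F : {rmorphism F -> F}) 2%:R.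
  by rewrite rmorph_nat.
by rewrite fmorph_eq0 Num.Theory.pnatr_eq0.
Qed.

Lemma pole_scalar (i : 'I_5) (c : F) f g (q : 5.-tuple F) (r : F)
    (K : fieldType) (iota : {rmorphism F -> K}) (p : 5.-tuple K) v :
  f * (ff_var R i - ff_scalar c) = g -> tnth q i = c ->
  val idfun q g r -> r != 0 -> val iota p f v -> tnth p i != iota c.
Proof. by move=> fg qi gr r0; apply: pole_no_value qi r0 _; rewrite fg. Qed.

Lemma s0_preserves b s :
  coordinate_images s = (X, Y, Z - B0 / (X - e), - B0, B1 + B0, B2) ->
  preserves_system eta b s.
Proof.
case=> sX sY sZ s0 s1 s2 K iota D ext b0 b1 b2 x y z sol p x' y' z' b0' b1' b2'.
rewrite sX sY sZ s0 s1 s2 => hx hy hz h0 h1 h2.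
pose c := constants iota.
have xe : x - c eta != 0.
  rewrite subr_eq0.
  (* On x = eta the cleared function is - beta0. *)
  apply: (@pole_scalar (@Ordinal 5 0 isT) (ratC_const eta) _ _
    [tuple ratC_const eta; 0; 1; 0; 0] _ K iota p) (hz).
  - by apply: clear_pole_s0; apply: Xe_neq0.
  - by [].
  - by values.
  - by apply: residue_s0_neq0; apply: subrr.
have [/(const_beta0 iota) sum _ _ _] := sol.
exists (- b0), (b1 + b0), b2.
have -> : x' = x := has_value_uniq hx (val_x _ _ _ _ _ _).
have -> : y' = y := has_value_uniq hy (val_y _ _ _ _ _ _).
have -> : b2' = c b2 := has_value_uniq h2 (val_b2 _ _ _ _ _ _).
have -> : b0' = - c b0 by rewrite sum; apply: has_value_uniq h0 _; values.
have -> : b1' = c b1 + c b0 by rewrite sum; apply: has_value_uniq h1 _; values.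
have -> : z' = z - c b0 / (x - c eta).
  by rewrite sum; apply: has_value_uniq hz _; values.
split; first by rewrite -[LHS]rmorphN.
- by rewrite -[LHS]rmorphD.
- by [].
- exact: s0_solution.
Qed.

Lemma s1_preserves b s :
  coordinate_images s = (X + B1 / Z, Y + B1 / Z, Z, B0 + B1, - B1, B2 + B1) ->
  preserves_system eta b s.
Proof.
case=> sX sY sZ s0 s1 s2 K iota D ext b0 b1 b2 x y z sol p x' y' z' b0' b1' b2'.
rewrite sX sY sZ s0 s1 s2 => hx hy hz h0 h1 h2.
pose c := constants iota.
have z0 : z != 0.
  rewrite -(rmorph0 iota).
  (* On z = 0 the cleared function is beta1. *)
  apply: (@pole_scalar (@Ordinal 5 2 isT) 0 _ _
    [tuple 0; 0; 0; 1; 0] _ K iota p) (hx).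
  - by rewrite scalar0; apply: clear_pole_s1; apply: Z_neq0.
  - by [].
  - by values.
  - by rewrite mul0r add0r oner_neq0.
have [/(const_beta0 iota) sum _ _ _] := sol.
exists (b0 + b1), (- b1), (b2 + b1).
have -> : x' = x + c b1 / z by apply: has_value_uniq hx _; values.
have -> : y' = y + c b1 / z by apply: has_value_uniq hy _; values.
have -> : z' = z := has_value_uniq hz (val_z _ _ _ _ _ _).
have -> : b0' = c b0 + c b1 by rewrite sum; apply: has_value_uniq h0 _; values.
have -> : b1' = - c b1 by apply: has_value_uniq h1 _; values.
have -> : b2' = c b2 + c b1 by apply: has_value_uniq h2 _; values.
split; first by rewrite -[LHS]rmorphD.
- by rewrite -[LHS]rmorphN.
- by rewrite -[LHS]rmorphD.
- exact: s1_solution.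
Qed.

Lemma s2_preserves b s :
  coordinate_images s =
    (X, Y, Z - B2 * (Y * (Y - 1) + X * (Y - 1) + X * Y) / (X * Y * (Y - 1)),
     B0, B1 + 3 * B2, - B2) ->
  preserves_system eta b s.
Proof.
case=> sX sY sZ s0 s1 s2 K iota D ext b0 b1 b2 x y z sol p x' y' z' b0' b1' b2'.
rewrite sX sY sZ s0 s1 s2 => hx hy hz h0 h1 h2.
pose c := constants iota.
have X0 := X_neq0; have Y0 := Y_neq0; have W0 := Y1_neq0.
have n1 : 0 - 1 != 0 :> F by rewrite sub0r oppr_eq0 oner_neq0.
have n2 : 1 + 1 - 1 != 0 :> F by rewrite addrK oner_neq0.
(* On each of the three components the cleared function is - beta2; the
   remaining coordinates, in particular y = 2 in the first case, keep the
   point off the other two components. *)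
have x0 : x != 0.
  rewrite -(rmorph0 iota).
  apply: (@pole_scalar (@Ordinal 5 0 isT) 0 _ _
    [tuple 0; 1 + 1; 0; 0; 1] _ K iota p) (hz).
  - by rewrite scalar0; apply: clear_pole_s2_x.
  - by [].
  - by values; [exact: two_neq0 | exact: n2].
  - exact: residue_s2_neq0.
have y0 : y != 0.
  rewrite -(rmorph0 iota).
  apply: (@pole_scalar (@Ordinal 5 1 isT) 0 _ _
    [tuple 1; 0; 0; 0; 1] _ K iota p) (hz).
  - by rewrite scalar0; apply: clear_pole_s2_y.
  - by [].
  - by values; [exact: oner_neq0 | exact: n1].
  - exact: residue_s2_neq0.
have w0 : y - 1 != 0.
  rewrite subr_eq0 -(rmorph1 iota).
  apply: (@pole_scalar (@Ordinal 5 1 isT) 1 _ _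
    [tuple 1; 1; 0; 0; 1] _ K iota p) (hz).
  - by rewrite scalar1; apply: clear_pole_s2_w.
  - by [].
  - by values; exact: oner_neq0.
  - by apply: residue_s2_neq0; apply: subrr.
have [/(const_beta0 iota) sum _ _ _] := sol.
exists b0, (b1 + 3 * b2), (- b2).
have -> : x' = x := has_value_uniq hx (val_x _ _ _ _ _ _).
have -> : y' = y := has_value_uniq hy (val_y _ _ _ _ _ _).
have -> : z' =
    z - c b2 * (y * (y - 1) + x * (y - 1) + x * y) / (x * y * (y - 1)).
  by apply: has_value_uniq hz _; values; rewrite ?mulf_neq0.
have -> : b0' = c b0 by rewrite sum; apply: has_value_uniq h0 _; values.
have -> : b1' = c b1 + 3 * c b2 by apply: has_value_uniq h1 _; values.
have -> : b2' = - c b2 by apply: has_value_uniq h2 _; values.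
split=> //.
- by rewrite -(rmorph_nat c) -rmorphM -[LHS]rmorphD.
- by rewrite -[LHS]rmorphN.
- exact: s2_solution.
Qed.

(** * The action of words on the coordinates *)

Definition coords (w : {rmorphism FF -> FF}) :=
  (w X, w Y, w Z, w B1, w B2).

Lemma regular_coords w : regular (coords w).
Proof.
apply/and4P; split; rewrite ?fmorph_eq0.
- exact: X_neq0.
- exact: Y_neq0.
- by rewrite -(rmorph1 w) -rmorphB fmorph_eq0; apply: Y1_neq0.
- exact: Z_neq0.
Qed.

Definition compose (s t : {rmorphism FF -> FF}) : {rmorphism FF -> FF} :=
  GRing.RMorphism.clone _ _ (s \o t) _.

Lemma compose_scalars s t :
  fixes_scalars s -> fixes_scalars t -> fixes_scalars (compose s t).
Proof. by move=> fs ft c; apply: etrans (congr1 s (ft c)) (fs c). Qed.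

Lemma coords_inj s t : fixes_scalars s -> fixes_scalars t ->
  coords s = coords t -> s =1 t.
Proof.
move=> fs ft [eX eY eZ e1 e2]; apply: coordinate_ext => // c.
exact: etrans (fs c) (esym (ft c)).
Qed.

Section Word.
Variable w : {rmorphism FF -> FF}.

(** Since w (s f) is the rational expression s f in the coordinates moved by w,
    the generator appended last to a word acts as the outermost move. *)
Lemma coords_compose1 s :
  coordinate_images s = (X + B1 / Z, Y + B1 / Z, Z, B0 + B1, - B1, B2 + B1) ->
  coords (compose w s) = move1 (coords w).
Proof.
case=> eX eY eZ _ e1 e2; rewrite /coords /= eX eY eZ e1 e2.
by rewrite !rmorphD rmorphN fmorph_div.
Qed.

Lemma coords_compose2 s :
  coordinate_images s =
    (X, Y, Z - B2 * (Y * (Y - 1) + X * (Y - 1) + X * Y) / (X * Y * (Y - 1)),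
     B0, B1 + 3 * B2, - B2) ->
  coords (compose w s) = move2 (coords w).
Proof.
case=> eX eY eZ _ e1 e2; rewrite /coords /= eX eY eZ e1 e2.
rewrite rmorphB fmorph_div !rmorphM !rmorphD !rmorphM !rmorphB !rmorphN rmorph1.
by rewrite rmorph_nat.
Qed.

Lemma coords_compose0 (u : FF) s : w u = u ->
  coordinate_images s = (X, Y, Z - B0 / (X - u), - B0, B1 + B0, B2) ->
  coords (compose w s) = move0 u (coords w).
Proof.
move=> wu [eX eY eZ _ e1 e2]; rewrite /coords /= eX eY eZ e1 e2.
rewrite rmorphB fmorph_div [w (X - u)]rmorphB wu.
rewrite [w (B1 + _)]rmorphD /ff_beta0.
by rewrite !rmorphB !rmorphM rmorph1 !rmorph_nat.
Qed.
End Word.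
End Generators.

(** * The symmetry *)

Local Notation "w ** s" := (compose w s) (at level 40, left associativity).

Theorem theorem6p1 (R : realType) (eta : R[i]) (b : ratC R)
    (heta : eta != 0) (hb : b != 0) :
  let x := ff_x R in let y := ff_y R in let z := ff_z R in
  let beta0 := ff_beta0 R in
  let beta1 := ff_beta1 R in
  let beta2 := ff_beta2 R in
  let e := ff_scalar (ratC_const eta) in
  exists s0 s1 s2 : {rmorphism function_field R -> function_field R},
    [/\ coordinate_images s0 =
          (x, y, z - beta0 / (x - e), - beta0, beta1 + beta0, beta2),
        coordinate_images s1 =
          (x + beta1 / z, y + beta1 / z, z,
           beta0 + beta1, - beta1, beta2 + beta1),
        coordinate_images s2 =
          (x, y,
           z - beta2 * (y * (y - 1) + x * (y - 1) + x * y)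
               / (x * y * (y - 1)),
           beta0, beta1 + 3 * beta2, - beta2)
      & affine_Weyl_G2_symmetry eta b s0 s1 s2].
Proof.
move=> x y z beta0 beta1 beta2 e.
have [s0 [i0 f0 ss0]] := s0_exists eta.
have [s1 [i1 f1 ss1]] := s1_exists R.
have [s2 [i2 f2 ss2]] := s2_exists R.
exists s0, s1, s2; split=> //.
have bij (s : {rmorphism function_field R -> function_field R}) :
  s \o s =1 id -> bijective s by move=> ss; exists s.
split.
- by split; [split; [exact: bij|] | exact: s0_preserves].
- by split; [split; [exact: bij|] | exact: s1_preserves].
- by split; [split; [exact: bij|] | exact: s2_preserves].
split=> //.
pose FF : fieldType := function_field R.
pose id' : {rmorphism FF -> FF} := GRing.RMorphism.clone _ _ idfun _.
have fid : fixes_scalars id' by [].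
have fcomp := @compose_scalars R.
have offP w : fixes_scalars w -> w x - e != 0.
  move=> fw; rewrite (_ : w x - e = w (x - e)).
    by rewrite fmorph_eq0; apply: Xe_neq0.
  by rewrite rmorphB [w e]fw.
have C1 w := @coords_compose1 R w s1 i1.
have C2 w := @coords_compose2 R w s2 i2.
have C0 w (fw : fixes_scalars w) := coords_compose0 (fw _) i0.
split.
- apply: iter_braid3 => //.
  apply: (@coords_inj _ (id' ** s0 ** s1 ** s0) (id' ** s1 ** s0 ** s1)).
  + by repeat first [assumption | apply fcomp].
  + by repeat first [assumption | apply fcomp].
  rewrite C0 ?C1 ?C0 ?C1; try by repeat first [assumption | apply fcomp].
  have reg := regular_coords.
  by apply: braid01; rewrite -?C0 -?C1 -?C0 //; try apply: offP;
    repeat first [assumption | apply fcomp].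
- apply: iter_braid6 => //.
  apply: (@coords_inj _ (id' ** s1 ** s2 ** s1 ** s2 ** s1 ** s2)
                        (id' ** s2 ** s1 ** s2 ** s1 ** s2 ** s1)).
  + by repeat first [assumption | apply fcomp].
  + by repeat first [assumption | apply fcomp].
  rewrite !(C1, C2).
  by apply: braid12; rewrite -?C1 -?C2 -?C1 -?C2 -?C1 -?C2 ?regular_coords.
- apply: iter_braid2 => //.
  apply: (@coords_inj _ (id' ** s0 ** s2) (id' ** s2 ** s0)).
  + by repeat first [assumption | apply fcomp].
  + by repeat first [assumption | apply fcomp].
  by rewrite C2 !C0 ?C2 ?commute02 //; repeat first [assumption | apply fcomp].
Qed.
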